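(* The Garside element of the Artin monoid $\mathcal{M}(F_4)$ is $$\Delta(F_4)=x_1x_2x_1(x_3x_2x_1x_3x_2x_3)\,x_4\,(x_3x_2x_1x_3x_2x_3)\,x_4\,(x_3x_2x_1x_3x_2x_3)\,x_4.$$
   Context: $\mathcal{M}(F_4)$ is the monoid with generators $x_1,x_2,x_3,x_4$ and relations $x_1x_2x_1=x_2x_1x_2$, $x_2x_3x_2x_3=x_3x_2x_3x_2$, $x_3x_4x_3=x_4x_3x_4$, $x_1x_3=x_3x_1$, $x_1x_4=x_4x_1$, $x_2x_4=x_4x_2$. The notation $\alpha\mid_L\beta$ means $\beta=\alpha\rho$ for some element $\rho$. The Garside element $\Delta$ of this monoid is the unique element such that $x_i\mid_L\Delta$ for all $i$, and whenever $x_i\mid_L\omega$ for all $i$ then $\Delta\mid_L\omega$. *)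

(* Defs.v *)
From HB Require Import structures.
From mathcomp Require Import all_boot.
From mathcomp Require Import boolp.

Set Implicit Arguments.
Unset Strict Implicit.
Unset Printing Implicit Defensive.

Local Open Scope group_scope.
Local Open Scope quotient_scope.

Definition ldivides (M : monoidType) (a b : M) : Prop := exists r : M, b = a * r.

Definition garside_element (M : monoidType) (I : Type) (x : I -> M) (d : M) : Prop :=
  (forall i, ldivides (x i) d) /\
  (forall w : M, (forall i, ldivides (x i) w) -> ldivides d w).

(* The monoid < X | l = r for (l, r) in rels >: the quotient of the free monoid
   [seq X] by the least congruence containing rels. *)
Section PresentedMonoid.

Variables (X : choiceType) (rels : seq (seq X * seq X)).

Inductive word_equiv : seq X -> seq X -> Prop :=
| word_equiv_rel l r : (l, r) \in rels -> word_equiv l r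
| word_equiv_cat u u' v v' :
    word_equiv u u' -> word_equiv v v' -> word_equiv (u ++ v) (u' ++ v')
| word_equiv_refl u : word_equiv u u
| word_equiv_sym u v : word_equiv u v -> word_equiv v u
| word_equiv_trans u v w : word_equiv u v -> word_equiv v w -> word_equiv u w.

Definition word_equivb (u v : seq X) : bool := `[< word_equiv u v >].

Lemma word_equivb_refl : reflexive word_equivb.
Proof. by move=> u; apply/asboolP; exact: word_equiv_refl. Qed.

Lemma word_equivb_sym : symmetric word_equivb.
Proof.
by move=> u v; apply/asboolP/asboolP => ?; exact: word_equiv_sym.
Qed.

Lemma word_equivb_trans : transitive word_equivb.
Proof.
by move=> v u w /asboolP uv /asboolP vw; apply/asboolP; exact: word_equiv_trans vw.
Qed.

Canonical word_equivb_equiv :=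
  EquivRel word_equivb word_equivb_refl word_equivb_sym word_equivb_trans.

Definition presented_monoid : Type := {eq_quot word_equivb}.

HB.instance Definition _ := Choice.on presented_monoid.
HB.instance Definition _ := EqQuotient.on presented_monoid.

Definition class_of_word (w : seq X) : presented_monoid := \pi w.

Lemma class_of_wordP (u v : seq X) :
  class_of_word u = class_of_word v <-> word_equiv u v.
Proof.
split=> [/eqmodP/asboolP //|uv]; apply/eqmodP; exact/asboolP.
Qed.

Lemma repr_class_of_word (w : seq X) : word_equiv (repr (class_of_word w)) w.
Proof. by apply/class_of_wordP; rewrite /class_of_word reprK. Qed.

Definition presented_mul (a b : presented_monoid) : presented_monoid :=
  class_of_word (repr a ++ repr b).

Lemma presented_mulE (u v : seq X) :
  presented_mul (class_of_word u) (class_of_word v) = class_of_word (u ++ v).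
Proof.
apply/class_of_wordP; apply: word_equiv_cat; exact: repr_class_of_word.
Qed.

Lemma class_of_word_repr (a : presented_monoid) : class_of_word (repr a) = a.
Proof. by rewrite /class_of_word reprK. Qed.

Lemma presented_mulA : associative presented_mul.
Proof.
move=> a b c; rewrite -(class_of_word_repr a) -(class_of_word_repr b).
by rewrite -(class_of_word_repr c) !presented_mulE catA.
Qed.

Lemma presented_mul1 : left_id (class_of_word [::]) presented_mul.
Proof. by move=> a; rewrite -(class_of_word_repr a) presented_mulE. Qed.

Lemma presented_mulr1 : right_id (class_of_word [::]) presented_mul.
Proof. by move=> a; rewrite -(class_of_word_repr a) presented_mulE cats0. Qed.

HB.instance Definition _ :=
  isMonoid.Build presented_monoid presented_mulA presented_mul1 presented_mulr1.

Definition generator (i : X) : presented_monoid := class_of_word [:: i].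

End PresentedMonoid.

(* x_k is indexed by the ordinal k - 1. *)
Definition i1 : 'I_4 := @Ordinal 4 0 isT.
Definition i2 : 'I_4 := @Ordinal 4 1 isT.
Definition i3 : 'I_4 := @Ordinal 4 2 isT.
Definition i4 : 'I_4 := @Ordinal 4 3 isT.

Definition F4_relations : seq (seq 'I_4 * seq 'I_4) :=
  [:: ([:: i1; i2; i1], [:: i2; i1; i2]);
      ([:: i2; i3; i2; i3], [:: i3; i2; i3; i2]);
      ([:: i3; i4; i3], [:: i4; i3; i4]);
      ([:: i1; i3], [:: i3; i1]);
      ([:: i1; i4], [:: i4; i1]);
      ([:: i2; i4], [:: i4; i2])].

Definition artin_monoid_F4 : monoidType := presented_monoid F4_relations.

Definition F4_generator (i : 'I_4) : artin_monoid_F4 := generator F4_relations i.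

Definition x1 : artin_monoid_F4 := F4_generator i1.
Definition x2 : artin_monoid_F4 := F4_generator i2.
Definition x3 : artin_monoid_F4 := F4_generator i3.
Definition x4 : artin_monoid_F4 := F4_generator i4.

(* Main.v *)
Require Import Defs.
From mathcomp Require Import all_boot.
Set Implicit Arguments.
Unset Strict Implicit.
Unset Printing Implicit Defensive.

Local Open Scope group_scope.

(** The generators of M(F4) have least common right multiples that can be
    computed by word reversing, and the stated word is the least common
    multiple of x1, x2, x3, x4; everything reduces to justifying reversing.

    Every relation of an Artin monoid has the form [i C(i,j) = j C(j,i)], with
    one relation for each pair of generators, and relates words of equal length.
    The reduction property of Garside and Brieskorn-Saito says that whenever
    [i u = j v] there is [g] with [u = C(i,j) g] and [v = C(j,i) g].  Two
    consequences follow.  Iterated on the letters of two words [a] and [b], the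
    property shows that every common right multiple of [a] and [b] is a multiple
    of the one which reversing produces ([reverse_least]).  Taking [i = j], where
    [C(i,i)] is empty, it contains left cancellation.

    The reduction property is proved by induction on the length of the words
    ([equiv_reduction]).  It is stable under all closure rules of the congruence;
    only transitivity [i u = k w = j v] requires an argument.  There the two
    hypotheses write [w] both as a multiple of [C(k,i)] and as a multiple of
    [C(k,j)]; as [w] is shorter than [k w], the property at smaller length
    applies to it, and [w] is a multiple of the result of reversing [C(k,i)]
    against [C(k,j)].  The remaining compatibility is Dehornoy's cube condition
    on the triple of letters [i, j, k], a statement about finitely many
    explicit words.  All parabolic subgroups of rank 3 of F4 are finite, so
    reversing terminates on all these words and the 64 instances are decided by
    computation, as is the final least common multiple.

    Uniqueness holds because the length of words is an invariant: two elements
    dividing each other differ by a factor of length 0. *)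

(** * Word reversing in homogeneous complemented presentations *)

Section Reversing.

Variables (X : choiceType) (rels : seq (seq X * seq X)) (C : X -> X -> seq X).

Local Notation "u ~~~ v" := (word_equiv rels u v) (at level 70).

Hypothesis C_diag : forall i, C i i = [::].
Hypothesis C_size : forall i j, size (C i j) = size (C j i).
Hypothesis C_rel : forall i j, (i :: C i j) ~~~ (j :: C j i).
Hypothesis rels_C : forall l r, (l, r) \in rels ->
  exists i j, l = i :: C i j /\ r = j :: C j i.

Lemma word_equiv_size u v : u ~~~ v -> size u = size v.
Proof.
elim=> {u v} [l r /rels_C [i [j [-> ->]]]|u u' v v' _ Hu _ Hv|//|//|u v w _ -> //].
  by rewrite /= C_size.
by rewrite !size_cat Hu Hv.
Qed.

Lemma word_equiv_catl w u v : u ~~~ v -> (w ++ u) ~~~ (w ++ v).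
Proof. by apply: word_equiv_cat; exact: word_equiv_refl. Qed.

Lemma word_equiv_catr w u v : u ~~~ v -> (u ++ w) ~~~ (v ++ w).
Proof. by move=> uv; apply: word_equiv_cat uv _; exact: word_equiv_refl. Qed.

(** The result [(b', a')] completes [a] and [b] to a common multiple
    [a b' = b a'].  The recursion tiles the rectangle with sides [a] and [b] by
    the elementary squares [i C(i,j) = j C(j,i)].  The fuel bounds the recursion
    depth, as reversing need not terminate for an arbitrary [C]. *)
Fixpoint reverse (fuel : nat) (a b : seq X) : option (seq X * seq X) :=
  match fuel, a, b with
  | _, [::], _ => Some (b, [::])
  | _, _, [::] => Some ([::], a)
  | 0, _, _ => None
  | n.+1, i :: a0, j :: b0 =>
    if reverse n a0 (C i j) is Some (c1, a1) then
      if reverse n b0 (C j i) is Some (d1, b1) then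
        if reverse n a1 b1 is Some (b2, a2) then Some (c1 ++ b2, d1 ++ a2)
        else None
      else None
    else None
  end.

Lemma reverse_cons n i a j b b' a' :
    reverse n (i :: a) (j :: b) = Some (b', a') ->
  exists m c1 a1 d1 b1 b2 a2,
    [/\ n = m.+1, reverse m a (C i j) = Some (c1, a1),
        reverse m b (C j i) = Some (d1, b1),
        reverse m a1 b1 = Some (b2, a2) & (b', a') = (c1 ++ b2, d1 ++ a2)].
Proof.
case: n => [//|m] /=.
case Ea: (reverse m a _) => [[c1 a1]|//].
case Eb: (reverse m b _) => [[d1 b1]|//].
case Ec: (reverse m a1 b1) => [[b2 a2]|//] [<- <-].
by exists m, c1, a1, d1, b1, b2, a2.
Qed.

Lemma reverse_nil_l n b : reverse n [::] b = Some (b, [::]).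
Proof. by case: n. Qed.

Lemma reverse_nil_r n a : reverse n a [::] = Some ([::], a).
Proof. by case: n => [|n]; case: a. Qed.

Lemma reverse_sound n a b b' a' :
  reverse n a b = Some (b', a') -> (a ++ b') ~~~ (b ++ a').
Proof.
elim: n a b b' a' => [|n IH] [|i a] [|j b] b' a';
  rewrite ?reverse_nil_l ?reverse_nil_r //; last first.
  case/reverse_cons=> m [c1 [a1 [d1 [b1 [b2 [a2 [[<-] /IH Ea /IH Eb /IH Ec]]]]]]].
  case=> -> ->; rewrite !cat_cons !catA.
  apply: (word_equiv_trans (word_equiv_catl [:: i] (word_equiv_catr b2 Ea))).
  apply: word_equiv_sym.
  apply: (word_equiv_trans (word_equiv_catl [:: j] (word_equiv_catr a2 Eb))).
  rewrite -!catA ![[:: _] ++ _ ++ _]catA.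
  apply: word_equiv_cat; [exact: C_rel | exact: word_equiv_sym].
all: by case=> <- <-; rewrite ?cats0; exact: word_equiv_refl.
Qed.

(** * The reduction property *)

(** The conclusion of the reduction property for a pair of equivalent words.
    It is stated on whole words, so that an induction on derivations of
    equivalence can carry it. *)
Definition reduction (u v : seq X) : Prop :=
  match u, v with
  | [::], [::] => True
  | i :: a, j :: b => exists g, a ~~~ (C i j ++ g) /\ b ~~~ (C j i ++ g)
  | _, _ => False
  end.

Definition reduction_below (n : nat) : Prop :=
  forall u v, size u < n -> u ~~~ v -> reduction u v.

(** The multiple produced by [reverse] is the least one: each elementary square
    of the tiling is an application of the reduction property.  The bound on
    lengths makes the lemma usable while that property is being proved. *)
Lemma reverse_least_below N n a b b' a' x y :
    reduction_below N -> reverse n a b = Some (b', a') ->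
    size (a ++ x) < N -> (a ++ x) ~~~ (b ++ y) ->
  exists g, x ~~~ (b' ++ g) /\ y ~~~ (a' ++ g).
Proof.
move=> red; elim: n a b b' a' x y => [|n IH] [|i a] [|j b] b' a' x y;
  rewrite ?reverse_nil_l ?reverse_nil_r //; last first.
  case/reverse_cons=> m [c1 [a1 [d1 [b1 [b2 [a2 [[<-] Ea Eb Ec]]]]]]].
  case=> -> -> ltN E; have [g [ag bg]] := red _ _ ltN E.
  have ltNa: size (a ++ x) < N by exact: ltnW.
  have ltNb: size (b ++ y) < N.
    by move: ltN; rewrite (word_equiv_size E); exact: ltnW.
  have [d [xd gd]] := IH _ _ _ _ _ _ Ea ltNa ag.
  have [e [ye ge]] := IH _ _ _ _ _ _ Eb ltNb bg.
  have de: (a1 ++ d) ~~~ (b1 ++ e).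
    exact: word_equiv_trans (word_equiv_sym gd) ge.
  have ltNd: size (a1 ++ d) < N.
    apply: leq_ltn_trans ltNa; rewrite -(word_equiv_size gd).
    by rewrite (word_equiv_size ag) size_cat leq_addl.
  have [z [dz ez]] := IH _ _ _ _ _ _ Ec ltNd de.
  exists z; rewrite -!catA; split.
    exact: word_equiv_trans xd (word_equiv_catl _ dz).
  exact: word_equiv_trans ye (word_equiv_catl _ ez).
(* If one word is empty, the cofactor of the other one is the witness. *)
all: case=> <- <- _ E.
all: try by exists y; split=> //; exact: word_equiv_refl.
all: by exists x; split; [exact: word_equiv_refl | exact: word_equiv_sym].
Qed.

(** Decidable form of the cube condition.  If [i u = k w = j v] and [b'], [a']
    complete [C k i] and [C k j], then [u] and [v] are the multiples of
    [C i k ++ b'] and [C j k ++ a'] by a common word; the test says that these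
    are [C i j ++ e] and [C j i ++ e] for one and the same [e].  An empty
    component in the output of [reverse] witnesses a divisibility. *)
Definition cube (fuel : nat) (i j k : X) : bool :=
  if reverse fuel (C k i) (C k j) is Some (b', a') then
    if reverse fuel (C i j) (C i k ++ b') is Some (e, [::]) then
      reverse fuel (C j i ++ e) (C j k ++ a') == Some ([::], [::])
    else false
  else false.

Lemma cubeP fuel i j k : cube fuel i j k ->
  exists b' a' e, [/\ reverse fuel (C k i) (C k j) = Some (b', a'),
    (C i k ++ b') ~~~ (C i j ++ e) & (C j k ++ a') ~~~ (C j i ++ e)].
Proof.
rewrite /cube; case Er: (reverse _ (C k i) _) => [[b' a']|//].
case Ee: (reverse _ (C i j) _) => [[e [|//]]|//] /eqP/reverse_sound.
move/reverse_sound: Ee; rewrite !cats0 => Ee Ef.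
by exists b', a', e; split=> //; exact: word_equiv_sym.
Qed.

Variable fuel : nat.
Hypothesis cube_all : forall i j k, cube fuel i j k.

Lemma reduction_trans N u v w :
    reduction_below N -> size u <= N -> u ~~~ v ->
  reduction u v -> reduction v w -> reduction u w.
Proof.
move=> red leN uv; have := word_equiv_size uv.
case: u v w uv leN => [|i u] [|k w] [|j v] //= uv ltN [szu].
case=> g1 [ug wg] [g2 [wg' vg]].
have [b' [a' [e [Er Ei Ej]]]] := cubeP (cube_all i j k).
have gg: (C k i ++ g1) ~~~ (C k j ++ g2).
  exact: word_equiv_trans (word_equiv_sym wg) wg'.
have ltNg: size (C k i ++ g1) < N by rewrite -(word_equiv_size wg) -szu.
have [d [d1 d2]] := reverse_least_below red Er ltNg gg.
exists (e ++ d); rewrite !catA; split.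
  apply: (word_equiv_trans ug).
  apply: (word_equiv_trans (word_equiv_catl _ d1)).
  by rewrite catA; exact: word_equiv_catr.
apply: (word_equiv_trans vg).
apply: (word_equiv_trans (word_equiv_catl _ d2)).
by rewrite catA; exact: word_equiv_catr.
Qed.

(** The outer induction on length feeds [reduction_trans]; the inner one
    follows the derivation of the equivalence. *)
Lemma equiv_reduction u v : u ~~~ v -> reduction u v.
Proof.
suff red N : reduction_below N by move=> uv; exact: red (ltnSn _) uv.
elim: N {u v} => [//|N IH] u v ltN uv.
elim: uv ltN => {u v} [l r lr|u u' v v' uu' IHu vv' IHv|u|u v uv IHuv|u v w uv IHuv vw IHvw].
- have [i [j [-> ->]]] := rels_C lr.
  by move=> _; exists [::]; rewrite !cats0; split; exact: word_equiv_refl.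
- rewrite size_cat ltnS => leN.
  have {}IHu := IHu (leq_trans (leq_addr _ _) leN).
  have {}IHv := IHv (leq_trans (leq_addl _ _) leN).
  case: u u' IHu {uu' leN} => [|i a] [|j b] //= [g [ag bg]].
  exists (g ++ v); rewrite !catA; split; first exact: word_equiv_catr.
  apply: word_equiv_cat bg _; exact: word_equiv_sym.
- case: u => [//|i a] _; exists a.
  by rewrite C_diag; split; exact: word_equiv_refl.
- rewrite -(word_equiv_size uv) => /IHuv {IHuv uv}.
  by case: u v => [|i a] [|j b] //= [g [ag bg]]; exists g.
- move=> ltN; have ltNv: size v < N.+1 by rewrite -(word_equiv_size uv).
  exact: reduction_trans IH ltN uv (IHuv ltN) (IHvw ltNv).
Qed.

Lemma reverse_least n a b b' a' x y :
    reverse n a b = Some (b', a') -> (a ++ x) ~~~ (b ++ y) ->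
  exists g, x ~~~ (b' ++ g) /\ y ~~~ (a' ++ g).
Proof.
move=> Er; apply: (reverse_least_below _ Er (ltnSn _)) => u v _.
exact: equiv_reduction.
Qed.

(** * Garside elements *)

Definition word_divides (u w : seq X) : Prop := exists r, w ~~~ (u ++ r).

Fixpoint word_lcm (n : nat) (a : seq X) (s : seq X) : option (seq X) :=
  if s is i :: s' then
    if reverse n a [:: i] is Some (b', _) then word_lcm n (a ++ b') s'
    else None
  else Some a.

Lemma word_lcm_least n a s d w : word_lcm n a s = Some d ->
    word_divides a w -> (forall i, i \in s -> word_divides [:: i] w) ->
  word_divides d w.
Proof.
elim: s a => [|i s IH] a /=; first by case=> ->.
case Er: (reverse n a [:: i]) => [[b' a']|//] Es [x wx] ws.
have [y wy] := ws i (mem_head _ _).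
have [g [xg _]] := reverse_least Er (word_equiv_trans (word_equiv_sym wx) wy).
apply: IH Es _ _ => [|j js]; last by apply: ws; rewrite inE js orbT.
exists g; rewrite -catA.
exact: word_equiv_trans wx (word_equiv_catl _ xg).
Qed.

Lemma word_lcm_divides n a s d : word_lcm n a s = Some d ->
  word_divides a d /\ (forall i, i \in s -> word_divides [:: i] d).
Proof.
elim: s a => [|i s IH] a /=.
  by case=> ->; split=> //; exists [::]; rewrite cats0; exact: word_equiv_refl.
case Er: (reverse n a [:: i]) => [[b' a']|//] /IH [[r dr] ds].
split=> [|j]; first by exists (b' ++ r); rewrite catA.
rewrite inE => /orP [/eqP ->|/ds //].
exists (a' ++ r); rewrite catA; apply: (word_equiv_trans dr).
by apply: word_equiv_catr; exact: reverse_sound Er.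
Qed.

Lemma class_of_wordM u v :
  class_of_word rels u * class_of_word rels v = class_of_word rels (u ++ v).
Proof. exact: presented_mulE. Qed.

Lemma ldivides_class u v :
  ldivides (class_of_word rels u) (class_of_word rels v) <-> word_divides u v.
Proof.
split=> [[r]|[r vr]].
  by rewrite -(class_of_word_repr r) class_of_wordM => /class_of_wordP; exists (repr r).
by exists (class_of_word rels r); rewrite class_of_wordM; apply/class_of_wordP.
Qed.

(** Antisymmetry holds since the two quotients have total length 0. *)
Lemma ldivides_anti (a b : presented_monoid rels) :
  ldivides a b -> ldivides b a -> a = b.
Proof.
rewrite -(class_of_word_repr a) -(class_of_word_repr b).
move=> /ldivides_class [r br] /ldivides_class [s sa].
apply/class_of_wordP.
have := word_equiv_size br; rewrite size_cat (word_equiv_size sa) size_cat -addnA.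
move/eqP; rewrite -{1}[size (repr b)]addn0 eqn_add2l eq_sym addn_eq0.
case/andP=> /nilP s0 _.
by move: sa; rewrite s0 cats0.
Qed.

(** A word is compared with the computed least common multiple by reversing the
    two against each other: empty residues on both sides mean equivalence. *)
Theorem garside_of_word_lcm n s d e : (forall i, i \in s) ->
    word_lcm n [::] s = Some d -> reverse n d e = Some ([::], [::]) ->
  unique (garside_element (generator rels)) (class_of_word rels e).
Proof.
move=> s_all Ed /reverse_sound; rewrite !cats0 => /class_of_wordP <-.
have gd: garside_element (generator rels) (class_of_word rels d).
  have [_ ds] := word_lcm_divides Ed.
  split=> [i|w]; first by apply/ldivides_class/ds.
  rewrite -(class_of_word_repr w) => ws; apply/ldivides_class.
  apply: word_lcm_least Ed _ _; first by exists (repr w); exact: word_equiv_refl.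
  by move=> i _; apply/ldivides_class/ws.
split=> // d' [d'x d'min].
by apply: ldivides_anti; [exact: gd.2 | apply: d'min; exact: gd.1].
Qed.

End Reversing.

(** * The presentation of type F4 *)

Definition F4_exponent (i j : 'I_4) : nat :=
  match val i, val j with
  | 0, 1 | 1, 0 | 2, 3 | 3, 2 => 3%N
  | 1, 2 | 2, 1 => 4%N
  | _, _ => if i == j then 1%N else 2%N
  end.

Fixpoint alternating (T : Type) (n : nat) (a b : T) : seq T :=
  if n is n'.+1 then a :: alternating n' b a else [::].

(** The braid relation of [i] and [j] equates the alternating words of length
    [F4_exponent i j] starting with [i] and with [j]; this is what follows the
    first letter. *)
Definition F4_complement (i j : 'I_4) : seq 'I_4 :=
  alternating (F4_exponent i j).-1 j i.

Definition F4_letters : seq 'I_4 := [:: i1; i2; i3; i4].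

Lemma mem_F4_letters i : i \in F4_letters.
Proof. by case: i => [[|[|[|[|m]]]] lt] //; rewrite !inE -?val_eqE. Qed.

Lemma F4_complement_diag i : F4_complement i i = [::].
Proof.
have: all (fun i => F4_complement i i == [::]) F4_letters by [].
by move/allP/(_ i (mem_F4_letters i))/eqP.
Qed.

Lemma F4_complement_size i j :
  size (F4_complement i j) = size (F4_complement j i).
Proof.
have: all (fun i => all (fun j =>
  size (F4_complement i j) == size (F4_complement j i)) F4_letters) F4_letters by [].
by move/allP/(_ i (mem_F4_letters i))/allP/(_ j (mem_F4_letters j))/eqP.
Qed.

Lemma F4_complement_rel i j :
  word_equiv F4_relations (i :: F4_complement i j) (j :: F4_complement j i).
Proof.
pose p := (i :: F4_complement i j, j :: F4_complement j i).
have: [|| i == j, p \in F4_relations | (p.2, p.1) \in F4_relations].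
  rewrite /p; have: all (fun i => all (fun j =>
    let p := (i :: F4_complement i j, j :: F4_complement j i) in
    [|| i == j, p \in F4_relations | (p.2, p.1) \in F4_relations])
    F4_letters) F4_letters by [].
  by move/allP/(_ i (mem_F4_letters i))/allP/(_ j (mem_F4_letters j)).
case/or3P=> [/eqP -> |r|r]; first exact: word_equiv_refl.
  exact: word_equiv_rel.
exact/word_equiv_sym/word_equiv_rel.
Qed.

Lemma F4_relations_complement l r : (l, r) \in F4_relations ->
  exists i j, l = i :: F4_complement i j /\ r = j :: F4_complement j i.
Proof.
rewrite !inE => /or4P [/eqP[-> ->]|/eqP[-> ->]|/eqP[-> ->]|].
- by exists i1, i2.
- by exists i2, i3.
- by exists i3, i4.
case/or3P=> /eqP [-> ->]; [exists i1, i3 | exists i1, i4 | exists i2, i4]; by [].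
Qed.

(** The fuel, here and below, is a generous bound: any value on which every
    reversing terminates gives the same results. *)
Lemma F4_cube i j k : cube F4_complement 30 i j k.
Proof.
have: all (fun i => all (fun j => all (cube F4_complement 30 i j)
  F4_letters) F4_letters) F4_letters by vm_compute.
move/allP/(_ i (mem_F4_letters i))/allP/(_ j (mem_F4_letters j)).
by move/allP/(_ k (mem_F4_letters k)).
Qed.

Definition F4_garside_word : seq 'I_4 :=
  let b := [:: i3; i2; i1; i3; i2; i3; i4] in [:: i1; i2; i1] ++ b ++ b ++ b.

Definition word_lcm_reverses (n : nat) (e : seq 'I_4) : bool :=
  if word_lcm F4_complement n [::] F4_letters is Some d then
    reverse F4_complement n d e == Some ([::], [::])
  else false.

Lemma F4_garside_word_lcm : word_lcm_reverses 60 F4_garside_word.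
Proof. by vm_compute. Qed.

Theorem corollary5 :
  unique (garside_element F4_generator)
    (x1 * x2 * x1 * (x3 * x2 * x1 * x3 * x2 * x3) * x4
       * (x3 * x2 * x1 * x3 * x2 * x3) * x4
       * (x3 * x2 * x1 * x3 * x2 * x3) * x4).
Proof.
have := F4_garside_word_lcm; rewrite /word_lcm_reverses.
case Ed: (word_lcm _ _ _ _) => [d|//] /eqP Er.
rewrite /x1 /x2 /x3 /x4 /F4_generator /generator.
have := garside_of_word_lcm F4_complement_diag F4_complement_size
  F4_complement_rel F4_relations_complement F4_cube mem_F4_letters Ed Er.
congr (unique _ _).
(* Were the class map not abstract, the left-hand side of [clM] would also match
   the unfolded definition of a product, exposing representatives. *)
move: (class_of_word F4_relations) (@class_of_wordM _ F4_relations) => cl clM.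
by rewrite !clM.
Qed.
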